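(* Let $(a,b,c)$ be a primitive Pythagorean triple. Then the rank of the elliptic curve $$y^2=x(x-b^2)(x+c^2)$$ over $\mathbb{Q}$ is positive.
   Context: A primitive Pythagorean triple (PPT) is a triple $(a,b,c)$ of positive integers with $a^2+b^2=c^2$ and $\gcd(a,b,c)=1$. The rank of an elliptic curve $E$ over $\mathbb{Q}$ is the nonnegative integer $r$ such that $E(\mathbb{Q})\cong\mathbb{Z}^r\times E(\mathbb{Q})_{\mathrm{tors}}$. *)

(* Defs.v *)
From HB Require Import structures.
From mathcomp Require Import all_boot all_order all_algebra.
From mathcomp Require Import separable.
From mathcomp Require Import ring lra.

Set Implicit Arguments.
Unset Strict Implicit.
Unset Printing Implicit Defensive.

Import Order.TTheory GRing.Theory Num.Theory.
Local Open Scope ring_scope.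

Definition primitive_pythagorean_triple (a b c : nat) : Prop :=
  [/\ (0 < a)%N, (0 < b)%N, (0 < c)%N,
      (a ^ 2 + b ^ 2 = c ^ 2)%N & gcdn (gcdn a b) c = 1%N].

(* The elliptic curve y ^ 2 = f(x) over the rationals, for a monic cubic f;
   separability of f is nonsingularity of the curve. *)
Record elliptic_curve := EllipticCurve {
  cubic : {poly rat};
  cubic_monic : cubic \is monic;
  cubic_size : size cubic = 4%N;
  cubic_separable : separable_poly cubic
}.

(* None is the point at infinity, Some (x, y) the affine point (x, y). *)
Definition on_curve (E : elliptic_curve) (p : option (rat * rat)) : bool :=
  if p is Some (x, y) then y ^+ 2 == (cubic E).[x] else true.

Record point (E : elliptic_curve) := Point {
  coords : option (rat * rat);
  coordsP : on_curve E coords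
}.

HB.instance Definition _ (E : elliptic_curve) := [isSub for @coords E].
HB.instance Definition _ (E : elliptic_curve) := [Equality of point E by <:].

(* The chord-tangent law: the line of slope l through (x1, y1) and (x2, y2)
   (the tangent if these coincide) meets the curve again at an abscissa x3
   with x1 + x2 + x3 = l ^ 2 - f`_2, and the sum is the reflection of that
   third point in the x-axis. *)
Definition slope (E : elliptic_curve) (x1 y1 x2 y2 : rat) : rat :=
  if x1 == x2 then (cubic E)^`().[x1] / (2 * y1) else (y2 - y1) / (x2 - x1).

Definition add_coords (E : elliptic_curve) (p q : option (rat * rat)) :=
  match p, q with
  | None, _ => q
  | _, None => p
  | Some (x1, y1), Some (x2, y2) =>
      if (x1 == x2) && (y1 == - y2) then None else
      let l := slope E x1 y1 x2 y2 in
      let x3 := l ^+ 2 - (cubic E)`_2 - x1 - x2 in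
      Some (x3, l * (x1 - x3) - y1)
  end.

Lemma horner_cubic (E : elliptic_curve) (x : rat) :
  (cubic E).[x] = x ^+ 3 + (cubic E)`_2 * x ^+ 2 + (cubic E)`_1 * x
                  + (cubic E)`_0.
Proof.
have := cubic_monic E; rewrite monicE lead_coefE cubic_size /= => /eqP f3.
rewrite horner_coef cubic_size !big_ord_recr big_ord0 /= f3.
ring.
Qed.

Lemma horner_deriv_cubic (E : elliptic_curve) (x : rat) :
  (cubic E)^`().[x] = 3 * x ^+ 2 + 2 * (cubic E)`_2 * x + (cubic E)`_1.
Proof.
have := cubic_monic E; rewrite monicE lead_coefE cubic_size /= => /eqP f3.
have s : (size (cubic E)^`() <= 3)%N.
  by rewrite -ltnS -(cubic_size E) lt_size_deriv // -size_poly_eq0 cubic_size.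
rewrite (horner_coef_wide _ s) !big_ord_recr big_ord0 /= !coef_deriv f3.
ring.
Qed.

Lemma add_on_curve (E : elliptic_curve) (p q : option (rat * rat)) :
  on_curve E p -> on_curve E q -> on_curve E (add_coords E p q).
Proof.
case: p => [[x1 y1]|//]; case: q => [[x2 y2]|//] /eqP h1 /eqP h2 /=.
rewrite /slope; move: h1 h2; rewrite !horner_cubic horner_deriv_cubic.
set f2 := (cubic E)`_2; set f1 := (cubic E)`_1; set f0 := (cubic E)`_0.
move=> h1; have f0E : f0 = y1 ^+ 2 - x1 ^+ 3 - f2 * x1 ^+ 2 - f1 * x1
  by rewrite h1; ring.
case: eqVneq => [<- h2 | nx h2] /=.
  case: eqVneq => [//|ny] /=.
  have ny2 : y1 + y2 != 0 by rewrite -(opprK y2) subr_eq0.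
  have ey : y1 = y2 by apply: (mulIf ny2); lra.
  have nz : y1 != 0 by move: ny2; rewrite -ey; lra.
  by apply/eqP; rewrite horner_cubic -/f2 -/f1 -/f0 f0E; field.
have nz : x2 - x1 != 0 by rewrite subr_eq0 eq_sym.
have f1E : f1 = (y2 ^+ 2 - y1 ^+ 2) / (x2 - x1)
                - (x1 ^+ 2 + x1 * x2 + x2 ^+ 2) - f2 * (x1 + x2).
  by rewrite h2 f0E; field.
by apply/eqP; rewrite horner_cubic -/f2 -/f1 -/f0 f0E f1E; field.
Qed.

Definition ec_zero (E : elliptic_curve) : point E := @Point E None isT.

Definition ec_add (E : elliptic_curve) (P Q : point E) : point E :=
  Point (add_on_curve (coordsP P) (coordsP Q)).

Definition ec_mul (E : elliptic_curve) (n : nat) (P : point E) : point E :=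
  iter n (ec_add P) (ec_zero E).

Definition torsion (E : elliptic_curve) (P : point E) : Prop :=
  exists2 n : nat, (0 < n)%N & ec_mul n P = ec_zero E.

(* has_rank E r : E(Q) is isomorphic to Z ^ r x E(Q)_tors; the isomorphism is
   P |-> (f P, t P). *)
Definition has_rank (E : elliptic_curve) (r : nat) : Prop :=
  exists (f : point E -> 'rV[int]_r) (t : point E -> point E),
    [/\ forall P Q, f (ec_add P Q) = f P + f Q,
        forall P Q, t (ec_add P Q) = ec_add (t P) (t Q),
        forall P, torsion (t P)
      & forall (u : 'rV[int]_r) (T : point E), torsion T ->
          exists! P, f P = u /\ t P = T].

Definition ppt_cubic (b c : nat) : {poly rat} :=
  'X * ('X - (b%:R ^+ 2)%:P) * ('X + (c%:R ^+ 2)%:P).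

Lemma ppt_cubicE (b c : nat) :
  ppt_cubic b c = \prod_(e <- [:: 0; b%:R ^+ 2; - c%:R ^+ 2]) ('X - e%:P).
Proof.
by rewrite !big_cons big_nil mulr1 subr0 polyCN opprK mulrA.
Qed.

Lemma ppt_cubic_monic (b c : nat) : ppt_cubic b c \is monic.
Proof. by rewrite ppt_cubicE monic_prod_XsubC. Qed.

Lemma size_ppt_cubic (b c : nat) : size (ppt_cubic b c) = 4%N.
Proof. by rewrite ppt_cubicE size_prod_XsubC. Qed.

Lemma ppt_cubic_separable (a b c : nat) :
  primitive_pythagorean_triple a b c -> separable_poly (ppt_cubic b c).
Proof.
case=> _ b0 c0 _ _; rewrite ppt_cubicE separable_prod_XsubC /= !inE.
have B : 0 < b%:R ^+ 2 :> rat by rewrite exprn_gt0 // ltr0n.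
have C : 0 < c%:R ^+ 2 :> rat by rewrite exprn_gt0 // ltr0n.
by rewrite negb_or andbT -!andbA; apply/and3P; split; apply/eqP; lra.
Qed.

Definition ppt_curve (a b c : nat) (h : primitive_pythagorean_triple a b c) :
    elliptic_curve :=
  EllipticCurve (ppt_cubic_monic b c) (size_ppt_cubic b c)
    (ppt_cubic_separable h).

(* Main.v *)
Require Import Defs.
From mathcomp Require Import all_boot all_order all_algebra.
From mathcomp Require Import separable ring lra zify.

Set Implicit Arguments.
Unset Strict Implicit.
Unset Printing Implicit Defensive.

Import Order.TTheory GRing.Theory Num.Theory.
Local Open Scope ring_scope.

(** The point [(- a ^ 2, abc)] lies on the curve and has infinite order, and
    this forces the rank to be positive because a curve of rank [0] has only
    torsion points (has_rank0_torsion).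

    The infinite order is seen at the prime [2].  In a primitive triple exactly
    one of [a, b] is even, so the abscissa of the double of that point,
    [(a ^ 4 + (bc) ^ 2) ^ 2 / (2abc) ^ 2], has an odd numerator and an even
    denominator (ppt_double_pole).  Once the abscissa of a point has a pole at
    [2], doubling the point multiplies the power of [4] in the denominator by
    [4] (double_pole).  So the points [2 ^ k * P] are pairwise distinct.

    A torsion point [P], on the other hand, has only finitely many multiples
    [n * P].  To conclude, the iterated doubles of [P] must be multiples of
    [P], that is, [n * P + n * P = (2n) * P] (ec_mul_double).  Full
    associativity of the chord-tangent law is avoided here: commutativity, the
    inverse property [- P + (P + Q) = Q] and the left alternative law
    [P + (P + Q) = (P + P) + Q] suffice.  The first two are symmetries of the
    relation that three affine points are the intersection of the curve with a
    line (collinear); the third is an identity between three such lines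
    (collinear_left_alternative). *)

(** * Lines meeting the curve in three affine points *)

Lemma cubic_smooth (E : elliptic_curve) (x : rat) :
  (cubic E).[x] = 0 -> (cubic E)^`().[x] != 0.
Proof.
move=> /eqP fx0; have := cubic_separable E; rewrite unlock => sep.
exact: coprimep_root sep fx0.
Qed.

(** The points [p, q, r] form the intersection divisor of the curve with the
    line [y = l x + m]: the last three equations compare coefficients in
    [cubic E - (l X + m) ^ 2 = (X - p.1) (X - q.1) (X - r.1)].  Tangency is
    covered by repeated points, so no case distinction is needed. *)
Definition collinear (E : elliptic_curve) (p q r : rat * rat) : Prop :=
  exists l m : rat,
    [/\ p.2 = l * p.1 + m, q.2 = l * q.1 + m, r.2 = l * r.1 + m
      & [/\ (cubic E)`_2 = l ^+ 2 - (p.1 + q.1 + r.1),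
            (cubic E)`_1 = 2 * l * m + p.1 * q.1 + p.1 * r.1 + q.1 * r.1
          & (cubic E)`_0 = m ^+ 2 - p.1 * q.1 * r.1]].

Lemma collinear_swap E p q r : collinear E p q r -> collinear E q p r.
Proof.
case=> l [m [hp hq hr [h2 h1 h0]]]; exists l, m.
by split=> //; rewrite h2 h1 h0; split; ring.
Qed.

(** Reflection in the x-axis carries lines to lines; combined with the
    chord-tangent law this is [p + q = r -> - p + r = q]. *)
Lemma collinear_opp_rot E x1 y1 x2 y2 x3 y3 :
  collinear E (x1, y1) (x2, y2) (x3, - y3) ->
  collinear E (x1, - y1) (x3, y3) (x2, - y2).
Proof.
case=> l [m [/= hp hq hr [h2 h1 h0]]]; exists (- l), (- m).
by rewrite h2 h1 h0 hp hq /=; split; [ring | lra | ring | split; ring].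
Qed.

(** Smoothness enters when [p = q = - q]: the line would then meet the curve
    doubly at a point of ordinate [0] without being vertical, which makes that
    point singular. *)
Lemma collinear_add E x1 y1 x2 y2 x3 y3 :
  collinear E (x1, y1) (x2, y2) (x3, y3) ->
  add_coords E (Some (x1, y1)) (Some (x2, y2)) = Some (x3, - y3).
Proof.
case=> l [m [/= hp hq hr [h2 h1 h0]]]; rewrite /slope.
have [e|nx] := eqVneq x1 x2; last first.
  have nz : x2 - x1 != 0 by rewrite subr_eq0 eq_sym.
  have -> : (y2 - y1) / (x2 - x1) = l by rewrite hp hq; field.
  by rewrite h2 hr hp; congr (Some (_, _)); ring.
have ey : y2 = y1 by rewrite hp hq e.
have d1 : (cubic E)^`().[x1] = 2 * y1 * l.
  by rewrite horner_deriv_cubic h2 h1 hp -e; ring.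
have [y0|ny] /= := eqVneq y1 (- y2).
  have y10 : y1 = 0 by lra.
  have /cubic_smooth : (cubic E).[x1] = 0.
    have -> : (cubic E).[x1] = y1 ^+ 2.
      by rewrite horner_cubic h2 h1 h0 hp -e; ring.
    by rewrite y10 expr0n.
  by rewrite d1 y10 mulr0 mul0r eqxx.
have nz : y1 != 0 by apply: contraNneq ny => y10; rewrite ey y10 oppr0.
have -> : (cubic E)^`().[x1] / (2 * y1) = l by rewrite d1; field.
by rewrite h2 hr hp -e; congr (Some (_, _)); ring.
Qed.

Lemma add_collinear E x1 y1 x2 y2 x3 y3 :
  on_curve E (Some (x1, y1)) -> on_curve E (Some (x2, y2)) ->
  add_coords E (Some (x1, y1)) (Some (x2, y2)) = Some (x3, y3) ->
  collinear E (x1, y1) (x2, y2) (x3, - y3).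
Proof.
move=> /eqP o1 /eqP o2 /=; rewrite /slope; move: o1 o2.
rewrite !horner_cubic horner_deriv_cubic.
set f2 := (cubic E)`_2; set f1 := (cubic E)`_1; set f0 := (cubic E)`_0.
move=> o1; have f0E : f0 = y1 ^+ 2 - x1 ^+ 3 - f2 * x1 ^+ 2 - f1 * x1
  by rewrite o1; ring.
have [<- o2|nx o2] /= := eqVneq x1 x2.
  have [//|ny] /= := eqVneq y1 (- y2).
  have ny2 : y1 + y2 != 0 by rewrite -(opprK y2) subr_eq0.
  have ey : y1 = y2 by apply: (mulIf ny2); lra.
  have nz : y1 != 0 by move: ny2; rewrite -ey; lra.
  rewrite -ey; set l := _ / _ => -[<- <-].
  have f1E : f1 = 2 * y1 * l - 3 * x1 ^+ 2 - 2 * f2 * x1.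
    by rewrite /l; field.
  clearbody l; exists l, (y1 - l * x1); rewrite /= -/f2 -/f1 -/f0 f0E f1E.
  by split; [ring | ring | ring | split; ring].
have nz : x2 - x1 != 0 by rewrite subr_eq0 eq_sym.
set l := _ / _ => -[<- <-].
have y2E : y2 = y1 + l * (x2 - x1) by rewrite /l; field.
have f1E : f1 = (y2 + y1) * l
                - (x1 ^+ 2 + x1 * x2 + x2 ^+ 2) - f2 * (x1 + x2).
  apply: (mulIf nz); apply: (etrans (y := y2 ^+ 2 - y1 ^+ 2
    - (x2 ^+ 3 - x1 ^+ 3) - f2 * (x2 ^+ 2 - x1 ^+ 2))).
    by rewrite o1 o2; ring.
  by rewrite y2E; ring.
clearbody l; exists l, (y1 - l * x1); rewrite /= -/f2 -/f1 -/f0 f0E f1E y2E.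
by split; [ring | ring | ring | split; ring].
Qed.

(** * The part of the group law that replaces associativity *)

Lemma add_coords_None E x1 y1 x2 y2 :
  add_coords E (Some (x1, y1)) (Some (x2, y2)) = None ->
  x2 = x1 /\ y2 = - y1.
Proof. by rewrite /=; case: ifP => // /andP[/eqP-> /eqP->]; rewrite opprK. Qed.

Definition opp_coords (p : option (rat * rat)) :=
  if p is Some (x, y) then Some (x, - y) else None.

Lemma opp_on_curve E p : on_curve E p -> on_curve E (opp_coords p).
Proof. by case: p => [[x y]|] //=; rewrite sqrrN. Qed.

Definition ec_opp (E : elliptic_curve) (P : point E) : point E :=
  Point (opp_on_curve (coordsP P)).

(** Read with [S = P + Q], [D = P + P] and [T = P + S], this turns [T] into
    [D + Q].  Take as parameters [y1], the slope [m] of the tangent at [P], and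
    [k, u] with [x3 = x1 - 2 y1 k], [x2 = x1 + u]: comparing the first two
    lines gives [l = m + k u], the third line then has slope [1 / k - l], and
    the line wanted through [D], [Q] and [- T] is the one of slope [1 / k - m].
    Because that line is exhibited, the cases where it is a tangent need no
    separate treatment. *)
Lemma collinear_left_alternative E x1 y1 x2 y2 x3 y3 x4 y4 x5 y5 :
  y1 != 0 -> x3 != x1 ->
  collinear E (x1, y1) (x2, y2) (x3, - y3) ->
  collinear E (x1, y1) (x1, y1) (x4, - y4) ->
  collinear E (x1, y1) (x3, y3) (x5, - y5) ->
  collinear E (x4, y4) (x2, y2) (x5, - y5).
Proof.
move=> ny nx [l [n1 [/= e1 e2 e3 [A1 B1 C1]]]] [m [n2 [/= d1 _ d3 [A2 B2 C2]]]]
  [l' [n3 [/= c1 c2 c3 [A3 B3 C3]]]].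
have [k x3E] : exists k, x3 = x1 - 2 * y1 * k.
  by exists ((x1 - x3) / (2 * y1)); field.
have [u x2E] : exists u, x2 = x1 + u by exists (x2 - x1); ring.
have nk : k != 0 by apply: contraNneq nx => k0; rewrite x3E k0 mulr0 subr0.
have n1E : n1 = y1 - l * x1 by rewrite e1; ring.
have n2E : n2 = y1 - m * x1 by rewrite d1; ring.
have n3E : n3 = y1 - l' * x1 by rewrite c1; ring.
have x4E : x4 = m ^+ 2 - l ^+ 2 + x1 + u - 2 * y1 * k.
  by have := etrans (esym A1) A2; rewrite x2E x3E => h; lra.
have lE : l = m + k * u.
  have ny2 : 2 * y1 != 0 by rewrite mulf_neq0.
  apply: (mulIf ny2); have := etrans (esym B1) B2.
  by rewrite n1E n2E x4E x2E x3E => h; lra.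
have l'E : l' = k^-1 - l.
  have nyk : 2 * y1 * k != 0 by rewrite !mulf_neq0.
  apply: (mulIf nyk); rewrite mulrBl (mulrC k^-1) (mulfK nk).
  by move: c2 e3; rewrite n3E n1E x3E => h h'; lra.
have x5E : x5 = l' ^+ 2 - l ^+ 2 + x1 + u.
  by have := etrans (esym A1) A3; rewrite x2E x3E => h; lra.
have y4E : y4 = - (m * x4 + n2) by rewrite -d3 opprK.
have y5E : y5 = - (l' * x5 + n3) by rewrite -c3 opprK.
have y2E : y2 = y1 + l * u by rewrite e2 n1E x2E; ring.
exists (k^-1 - m), (y2 - (k^-1 - m) * x2); rewrite /= A1 B1 C1.
rewrite y5E y4E x5E x4E n1E n2E n3E y2E x2E x3E l'E lE.
by split; [field | ring | field | split; field].
Qed.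

Section GroupLaw.

Variable E : elliptic_curve.
Implicit Types P Q R : point E.

Local Notation "P +' Q" := (ec_add P Q) (at level 50, left associativity).
Local Notation "-' P" := (ec_opp P) (at level 35, right associativity).
Local Notation O := (ec_zero E).

Lemma ec_add0 P : O +' P = P. Proof. exact/val_inj. Qed.

Lemma ec_addr0 P : P +' O = P.
Proof. by apply/val_inj; case: P => [[[x y]|] ?]. Qed.

Lemma ec_oppK P : -' -' P = P.
Proof. by apply/val_inj; case: P => [[[x y]|] ?] //=; rewrite opprK. Qed.

Lemma ec_addrN P : P +' -' P = O.
Proof.
by apply/val_inj; case: P => [[[x y]|] ?] //=; rewrite opprK !eqxx.
Qed.

Lemma ec_addNr P : -' P +' P = O.
Proof. by have := ec_addrN (-' P); rewrite ec_oppK. Qed.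

Lemma ec_add_eq0 P Q : P +' Q = O -> Q = -' P.
Proof.
case: P Q => [[[x1 y1]|] ?] [[[x2 y2]|] ?] /(congr1 val) e //;
  apply/val_inj => //.
by case: (add_coords_None e) => xE yE; rewrite /= xE yE.
Qed.

Lemma ec_addC P Q : P +' Q = Q +' P.
Proof.
case: P Q => [[[x1 y1]|] o1] [[[x2 y2]|] o2]; try exact/val_inj.
case e: (Point o1 +' Point o2) => [[[x3 y3]|] o3].
  apply/val_inj => /=.
  have := congr1 (@coords E) e; move=> /= /(add_collinear o1 o2).
  by move=> /collinear_swap/collinear_add /= ->; rewrite opprK.
have e0 : Point o1 +' Point o2 = O by rewrite e; apply/val_inj.
by rewrite -e e0 (ec_add_eq0 e0) ec_addNr.
Qed.

Lemma ec_addKl P Q : -' P +' (P +' Q) = Q.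
Proof.
case: P Q => [[[x1 y1]|] o1] [[[x2 y2]|] o2]; try exact/val_inj.
  case e: (Point o1 +' Point o2) => [[[x3 y3]|] o3].
    apply/val_inj.
    have := congr1 (@coords E) e; move=> /= /(add_collinear o1 o2).
    by move=> /collinear_opp_rot/collinear_add /= ->; rewrite opprK.
  have e0 : Point o1 +' Point o2 = O by rewrite e; apply/val_inj.
  by rewrite -e e0 (ec_add_eq0 e0) ec_addr0.
by rewrite (_ : Point o2 = O) ?ec_addr0 ?ec_addNr //; apply/val_inj.
Qed.

Lemma ec_addNKl P Q : P +' (-' P +' Q) = Q.
Proof. by rewrite -{1}(ec_oppK P) ec_addKl. Qed.

Lemma ec_add_idr P Q : P +' Q = P -> Q = O.
Proof. by move=> e; rewrite -(ec_addKl P Q) e ec_addNr. Qed.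

Lemma ec_oppD P : -' (P +' P) = -' P +' -' P.
Proof.
have h : (P +' P) +' -' P = P by rewrite (ec_addC _ (-' P)) ec_addKl.
have := ec_addKl (P +' P) (-' P); rewrite h => hP.
rewrite -{2}hP.
by rewrite (ec_addC (-' (P +' P)) P) ec_addKl.
Qed.

(** The degenerate positions of [P] and [Q] all reduce to the identity
    and inverse laws; the others are settled by collinear_left_alternative. *)
Lemma ec_add_left_alternative P Q : P +' (P +' Q) = (P +' P) +' Q.
Proof.
have [PP0|nPP] := eqVneq (P +' P) O.
  by rewrite PP0 ec_add0 {1}(ec_add_eq0 PP0) ec_addKl.
have [PS0|nPS] := eqVneq (P +' (P +' Q)) O.
  have -> : Q = -' (P +' P) by rewrite ec_oppD -{2}(ec_add_eq0 PS0) ec_addKl.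
  by rewrite ec_addrN ec_oppD ec_addNKl ec_addrN.
have [PQ0|nPQ] := eqVneq (P +' Q) O.
  rewrite PQ0 ec_addr0 (ec_add_eq0 PQ0) (ec_addC _ (-' P)).
  by rewrite ec_addKl.
case: P nPP nPS nPQ => [[[x1 y1]|] o1]; last by case/eqP; apply/val_inj.
case: Q => [[[x2 y2]|] o2] nPP nPS nPQ; last first.
  by rewrite (_ : Point o2 = O) ?ec_addr0 //; apply/val_inj.
have nO R : R != O -> exists x y, coords R = Some (x, y).
  case: R => [[[x y]|] o] nR; first by exists x, y.
  by case/eqP: nR; apply/val_inj.
have [x3 [y3 e3]] := nO _ nPQ.
have [x4 [y4 e4]] := nO _ nPP.
have [x5 [y5 e5]] := nO _ nPS.
apply/val_inj; rewrite [LHS]e5.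
have e3' := add_collinear o1 o2 e3.
have e4' := add_collinear o1 o1 e4.
have o3 : on_curve E (Some (x3, y3)) by rewrite -e3 coordsP.
have e5' : collinear E (x1, y1) (x3, y3) (x5, - y5).
  by apply: (add_collinear o1 o3); rewrite -e3 -e5.
have ny : y1 != 0.
  by apply: contraNneq nPP => y0; apply/eqP/val_inj; rewrite /= y0 oppr0 !eqxx.
have nx : x3 != x1.
  apply: contraNneq nPS => x31; apply/eqP/val_inj.
  case: e3' => l [m [/= a1 _ a3 _]].
  apply: (etrans (y := add_coords E (Some (x1, y1)) (Some (x3, y3)))).
    by rewrite -e3.
  have -> : y3 = - y1 by rewrite a1 -x31 -a3 opprK.
  by rewrite x31 /= opprK !eqxx.
have := collinear_add (collinear_left_alternative ny nx e3' e4' e5').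
by rewrite opprK -e4 => <-.
Qed.

Lemma ec_mulS n P : ec_mul n.+1 P = P +' ec_mul n P.
Proof. by []. Qed.

(** With [R = n * P] and [S = P + R], the left alternative law gives
    [S + S - P = S + (S - P) = S + R = P + (R + R)], and [- P] cancels. *)
Lemma ec_mul_double n P : ec_mul n P +' ec_mul n P = ec_mul n.*2 P.
Proof.
elim: n => [|n IHn]; first exact: ec_add0.
rewrite doubleS !ec_mulS -IHn; set R := ec_mul n P; set S := P +' R.
have SR : S +' R = P +' (R +' R).
  by rewrite /S (ec_addC _ R) (ec_addC P R) ec_add_left_alternative ec_addC.
have RE : S +' -' P = R by rewrite ec_addC ec_addKl.
have : (S +' S) +' -' P = P +' (R +' R)
  by rewrite -ec_add_left_alternative RE SR.
by rewrite ec_addC => <-; rewrite ec_addNKl.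
Qed.

(** * Torsion points and iterated doubling *)

Definition ec_double P := P +' P.

Lemma ec_mul_exp2 k P : ec_mul (2 ^ k) P = iter k ec_double P.
Proof.
elim: k => [|k IHk]; first exact: ec_addr0.
by rewrite expnS mul2n -ec_mul_double IHk.
Qed.

(** The multiples [n * P] depend only on [n] modulo the period, hence two of the
    exponents [2 ^ i] give the same multiple. *)
Lemma torsion_iter_double P :
  torsion P -> exists i j, i != j /\ iter i ec_double P = iter j ec_double P.
Proof.
case=> n n0 nP.
have period k : ec_mul (k %% n) P = ec_mul k P.
  rewrite [in RHS](divn_eq k n) addnC.
  elim: (k %/ n)%N => [|d ->]; first by rewrite mul0n addn0.
  rewrite mulSnr addnA; set m := (k %% n + _)%N.
  by rewrite /ec_mul [in RHS]iterD [in RHS](_ : iter n _ _ = O).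
(* Pigeonhole: n + 1 exponents, n residues. *)
pose f (i : 'I_n.+1) : 'I_n := Ordinal (ltn_pmod (2 ^ i) n0).
have /injectivePn [i [j nij fij]] : ~~ injectiveb f.
  by apply/injectiveP => /leq_card; rewrite !card_ord ltnn.
exists (i : nat), (j : nat); split; first exact: nij.
by rewrite -!ec_mul_exp2 -period -[RHS]period; have /(congr1 val) /= -> := fij.
Qed.

(** For rank [0] the second component [t] alone is an injective homomorphism
    into the torsion points, and injectivity carries torsion back. *)
Lemma has_rank0_torsion : has_rank E 0 -> forall P, torsion P.
Proof.
case=> f [t [_ tD ttors tinv]] P.
have t_inj : injective t.
  move=> Q R tQR; have [S [_ uS]] := tinv 0 (t Q) (ttors Q).
  have <- : S = Q by apply: uS; split=> //; rewrite thinmx0.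
  by apply: uS; split=> //; rewrite thinmx0.
have t0 : t O = O by apply: (@ec_add_idr (t O)); rewrite -tD ec_add0.
have tM n : t (ec_mul n P) = ec_mul n (t P).
  by elim: n => [//|n IHn]; rewrite !ec_mulS tD IHn.
have [n n0 nP] := ttors P; exists n => //.
by apply: t_inj; rewrite tM nP t0.
Qed.

(** The usual duplication formula, with the denominator [4 y ^ 2] rewritten in
    terms of the abscissa. *)
Lemma coords_double P x y :
  coords P = Some (x, y) -> y != 0 ->
  exists x' y', coords (ec_double P) = Some (x', y') /\
    x' * (4 * (cubic E).[x]) =
      (cubic E)^`().[x] ^+ 2 - 4 * (cubic E).[x] * ((cubic E)`_2 + 2 * x).
Proof.
case: P => p o /= e ny; move: o; rewrite {p}e => o.
have [x' [y' e]] : exists x' y', add_coords E (Some (x, y)) (Some (x, y))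
    = Some (x', y').
  case e: (add_coords _ _ _) => [[x' y']|]; first by exists x', y'.
  by case: (add_coords_None e) => _ y0; case/eqP: ny; lra.
exists x', y'; split=> //; move: e => /=.
have ny2 : y != - y by apply: contraNneq ny => y0; apply/eqP; lra.
rewrite eqxx (negPf ny2) /= /slope eqxx => -[<- _].
have /eqP <- := o.
by field.
Qed.

End GroupLaw.

(** * Poles at 2 of rational numbers *)

Definition oddz (z : int) : Prop := exists w : int, z = 2 * w + 1.

Lemma oddzM m n : oddz m -> oddz n -> oddz (m * n).
Proof. by case=> u -> [v ->]; exists (2 * u * v + u + v); ring. Qed.

Lemma oddzD2 m n : oddz m -> oddz (m + 2 * n).
Proof. by case=> u ->; exists (u + n); ring. Qed.

Lemma oddz_neq0 m : oddz m -> m%:~R != 0 :> rat.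
Proof. by case=> u ->; rewrite intr_eq0; lia. Qed.

Lemma oddz_nat n : odd n -> oddz n%:Z.
Proof. by move=> on; exists (n./2)%:Z; lia. Qed.

(** The 2-adic valuation of [x] is [- 2 k]. *)
Definition pole (k : nat) (x : rat) : Prop :=
  exists p q : int, [/\ oddz p, oddz q & x = p%:~R / (4 ^+ k * q%:~R)].

Lemma pole_inj i j x : pole i x -> pole j x -> i = j.
Proof.
wlog: i j / (i <= j)%N.
  move=> W; case/orP: (leq_total i j) => [/W//|/W h ? ?].
  by apply/esym/h.
rewrite leq_eqVlt => /predU1P[//|ij] [p [q [op oq xE]]] [p' [q' [op' oq' xE']]].
have [d jE] : exists d, j = (i + d).+1 by exists (j - i.+1)%N; lia.
have [u pqE] := oddzM op' oq.
suff : p' * q = 2 * (2 * 4 ^+ d * p * q') by rewrite pqE; lia.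
apply: (@intr_inj rat); rewrite !rmorphM /= rmorphXn /=.
have nq := oddz_neq0 oq; have nq' := oddz_neq0 oq'.
have n4 k : 4 ^+ k != 0 :> rat by rewrite expf_neq0.
have -> : p'%:~R = x * (4 ^+ j * q'%:~R) :> rat.
  by rewrite xE' mulfVK // mulf_neq0.
by rewrite xE jE exprS exprD; field; rewrite nq n4.
Qed.

(** * The curve of a primitive Pythagorean triple *)

Lemma coef_ppt_cubic b c :
  [/\ (ppt_cubic b c)`_2 = c%:R ^+ 2 - b%:R ^+ 2,
      (ppt_cubic b c)`_1 = - (b%:R * c%:R) ^+ 2 & (ppt_cubic b c)`_0 = 0].
Proof.
have -> : ppt_cubic b c = 'X^3 + (c%:R ^+ 2 - b%:R ^+ 2) *: 'X^2
    + (- (b%:R * c%:R) ^+ 2) *: 'X.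
  by rewrite /ppt_cubic -!mul_polyC rmorphB rmorphN exprMn rmorphM /=; ring.
by split; rewrite !coefD !coefZ !coefXn coefX /=; ring.
Qed.

Section PPTCurve.

Variables (a b c : nat) (h : primitive_pythagorean_triple a b c).
Local Notation E := (ppt_curve h).

(** On [y ^ 2 = x ^ 3 + A x ^ 2 + B x] the numerator of the duplication formula
    is a square. *)
Lemma coords_double_ppt (P : point E) x y :
  coords P = Some (x, y) -> y != 0 ->
  exists x' y', coords (ec_double P) = Some (x', y') /\
    x' = (x ^+ 2 + (b%:R * c%:R) ^+ 2) ^+ 2 / (4 * (cubic E).[x]).
Proof.
move=> Px ny; have [x' [y' [e x'E]]] := coords_double Px ny.
exists x', y'; split=> //.
have fx : (cubic E).[x] != 0.
  have := coordsP P; rewrite Px => /eqP <-; exact: expf_neq0.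
have n4 : 4 * (cubic E).[x] != 0 by rewrite mulf_neq0.
apply: (mulIf n4); rewrite mulfVK // x'E.
rewrite horner_deriv_cubic horner_cubic.
by have [-> -> ->] := coef_ppt_cubic b c; ring.
Qed.

(** Near the origin the abscissa behaves as [1 / z ^ 2] and doubling as
    [z |-> 2 z].  Concretely, for [x = p / (4 ^ k.+1 q)] the numbers
    [N] and [M] below, which are the numerators of [x ^ 2 + (bc) ^ 2] and of
    [(x - b ^ 2) (x + c ^ 2)], are congruent to [p ^ 2] modulo [2], and the
    double has abscissa [N ^ 2 / (4 ^ k.+2 q p M)]. *)
Lemma double_pole k (P : point E) x y :
  coords P = Some (x, y) -> pole k.+1 x ->
  exists x' y', coords (ec_double P) = Some (x', y') /\ pole k.+2 x'.
Proof.
move=> Px [p [q [op oq xE]]].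
have [B BE] : exists B : int, (b%:R * c%:R) ^+ 2 = B%:~R :> rat.
  by exists ((b%:Z * c%:Z) ^+ 2); rewrite rmorphXn rmorphM.
have [A AE] : exists A : int, c%:R ^+ 2 - b%:R ^+ 2 = A%:~R :> rat.
  by exists (c%:Z ^+ 2 - b%:Z ^+ 2); rewrite rmorphB !rmorphXn.
have [t tE] : exists t : int, 4 ^+ k = t%:~R :> rat.
  by exists (4 ^+ k); rewrite rmorphXn.
pose N : int := p ^+ 2 + 2 * (8 * B * t ^+ 2 * q ^+ 2).
pose M : int := p ^+ 2 + 2 * (2 * A * p * t * q - 8 * B * t ^+ 2 * q ^+ 2).
have oN : oddz N by apply/oddzD2/oddzM.
have oM : oddz M by apply/oddzD2/oddzM.
have nt : t%:~R != 0 :> rat by rewrite -tE expf_neq0.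
have [np nq] := (oddz_neq0 op, oddz_neq0 oq).
have nM := oddz_neq0 oM.
have fxE : (cubic E).[x] = p%:~R * M%:~R / (4 * t%:~R * q%:~R) ^+ 3.
  rewrite horner_cubic; have [-> -> ->] := coef_ppt_cubic b c.
  rewrite xE (exprS 4) tE AE BE.
  rewrite /M !(rmorph_nat, rmorphD, rmorphN, rmorphM, rmorphXn) /=.
  by field; rewrite nt nq.
have nfx : (cubic E).[x] != 0.
  by rewrite fxE !mulf_neq0 // invr_neq0 // expf_neq0 // !mulf_neq0.
have ny : y != 0.
  have := coordsP P; rewrite Px => /eqP fx.
  by apply: contraNneq nfx => y0; rewrite -fx y0 expr0n.
have [x' [y' [e x'E]]] := coords_double_ppt Px ny.
exists x', y'; split=> //.
exists (N * N), (q * p * M).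
split; [exact: oddzM | exact: oddzM (oddzM oq op) oM|].
rewrite x'E fxE xE !(exprS 4) tE BE !(intrM _ N) !(intrM _ _ M) (intrM _ q).
have -> : N%:~R = p%:~R ^+ 2 + 16 * B%:~R * t%:~R ^+ 2 * q%:~R ^+ 2 :> rat.
  by rewrite /N !(rmorph_nat, rmorphD, rmorphM, rmorphXn) /=; ring.
by field; apply/and4P.
Qed.

(** If [c] were even then [a, b] would be both even, against primitivity, or
    both odd, against squares being [0] or [1] modulo [4].  So [c] is odd and
    [a, b] have opposite parities. *)
Lemma ppt_odd : oddz (a%:Z ^+ 4 + (b%:Z * c%:Z) ^+ 2).
Proof.
have [_ _ _ abc gcd1] := h.
have oc : odd c.
  apply/negPn/negP => ec.
  have oab : odd a = odd b.
    by move: (congr1 odd abc); rewrite oddD !oddX /= (negPf ec); do 2!case: odd.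
  have [oa|ea] := boolP (odd a); last first.
    suff : (2 %| gcdn (gcdn a b) c)%N by rewrite gcd1.
    by rewrite !dvdn_gcd !dvdn2 -oab ea ec.
  have [aE bE cE] : [/\ a = (a./2).*2.+1, b = (b./2).*2.+1 & c = (c./2).*2].
    by split; lia.
  move: abc; rewrite aE bE cE; nia.
have o : odd (a ^ 4 + (b * c) ^ 2).
  move: (congr1 odd abc).
  by rewrite !oddD !oddX oddM oc andbT /= => ->.
by have := oddz_nat o; rewrite PoszD -!natz !natrX natrM !natz.
Qed.

(** The point [(- a ^ 2, abc)] is on the curve because
    [(- a ^ 2 - b ^ 2) = - c ^ 2] and [- a ^ 2 + c ^ 2 = b ^ 2].  It is
    integral itself; its double has a pole, of order fixed by the power of [2]
    in [abc]. *)
Lemma ppt_double_pole :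
  exists (P : point E) x y k, coords P = Some (x, y) /\ pole k.+1 x.
Proof.
have [a0 b0 c0 abc _] := h.
have abcR : a%:R ^+ 2 = c%:R ^+ 2 - b%:R ^+ 2 :> rat.
  by rewrite -!natrX -abc natrD; ring.
pose x : rat := - a%:R ^+ 2; pose y : rat := a%:R * b%:R * c%:R.
have fx : (cubic E).[x] = y ^+ 2.
  rewrite horner_cubic; have [-> -> ->] := coef_ppt_cubic b c.
  by rewrite -abcR /x /y; ring.
have o : on_curve E (Some (x, y)) by rewrite /on_curve fx.
have ny : y != 0 by rewrite !mulf_neq0 // pnatr_eq0 -lt0n.
have [x' [y' [e x'E]]] := @coords_double_ppt (Point o) x y erefl ny.
have abc0 : (0 < a * b * c)%N by rewrite !muln_gt0 a0 b0.
have [m com mE] := pfactor_coprime (isT : prime 2) abc0.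
move: mE; set e2 := logn 2 _ => mE.
exists (ec_double (Point o)), x', y', e2; split=> //.
have om : oddz m%:Z.
  by apply: oddz_nat; rewrite -coprime2n.
exists ((a%:Z ^+ 4 + (b%:Z * c%:Z) ^+ 2) ^+ 2), (m%:Z ^+ 2).
split; [exact: oddzM ppt_odd ppt_odd | exact: oddzM|].
have nm := oddz_neq0 om.
have n2 : 2 ^+ e2 != 0 :> rat by rewrite expf_neq0.
have yE : y = m%:~R * 2 ^+ e2 by rewrite /y -!natrM mE natrM natrX.
have e4 : 4 ^+ e2 = (2 ^+ e2) ^+ 2 :> rat by rewrite -exprM mulnC exprM.
have NE : (a%:Z ^+ 4 + (b%:Z * c%:Z) ^+ 2)%:~R
    = x ^+ 2 + (b%:R * c%:R) ^+ 2 :> rat.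
  by rewrite rmorphD !rmorphXn rmorphM /= /x; ring.
rewrite x'E fx yE (exprS 4) e4 !rmorphXn /= NE.
by field; rewrite nm n2.
Qed.

End PPTCurve.

Theorem theorem9p1 (a b c : nat) (h : primitive_pythagorean_triple a b c)
    (r : nat) (hr : has_rank (ppt_curve h) r) : (0 < r)%N.
Proof.
case: r hr => // /has_rank0_torsion tors.
have [P [x [y [k [Px poleP]]]]] := ppt_double_pole h.
have poles n : exists x' y',
    coords (iter n (@ec_double _) P) = Some (x', y') /\ pole (n + k).+1 x'.
  elim: n => [|n [x' [y' [e pn]]]]; first by exists x, y.
  by have := double_pole e pn.
have [i [j [/eqP nij eij]]] := torsion_iter_double (tors P).
have [xi [yi [ei pi]]] := poles i; have [xj [yj [ej pj]]] := poles j.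
move: ei; rewrite eij ej => -[xE _]; case: nij.
by rewrite xE in pj; have := pole_inj pi pj; lia.
Qed.
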